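(* Let $G$ be a finite group and let $F\leq K\leq G$ be subgroups. Then $$\varphi^{-1}(K,G)=\sum_{\substack{F\leq H\leq G\\ \langle H,K\rangle=G}}\varphi^{-1}(F,H)\,[G:H],$$ where the sum is over all subgroups $H$ of $G$ containing $F$ such that $H$ and $K$ together generate $G$.
   Context: For a finite group $G$, let $\mathcal{L}(G)$ be its set of subgroups, partially ordered by inclusion ($\leq$). The incidence algebra $\mathcal{W}(G)$ is the ring of functions $f:\mathcal{L}(G)\times\mathcal{L}(G)\to\mathbb{Z}$ with $f(H,K)=0$ whenever $H\not\leq K$, with pointwise addition and the convolution product $(f*h)(H,K)=\sum_{H\leq L\leq K}f(H,L)\,h(L,K)$; its unit element is $\delta$, with $\delta(H,K)=1$ if $H=K$ and $0$ otherwise. The zeta function $\zeta\in\mathcal{W}(G)$ has $\zeta(H,K)=1$ if $H\leq K$ and $0$ otherwise, and $\mu=\zeta^{-1}$ is the Möbius function. The index function $i\in\mathcal{W}(G)$ is $i(H,K)=[K:H]$ if $H\leq K$ and $0$ otherwise. The Euler totient function for $G$ is $\varphi=i*\mu\in\mathcal{W}(G)$; it is invertible in $\mathcal{W}(G)$, and $\varphi^{-1}$ denotes its inverse with respect to convolution. *)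

(* Defs.v *)
From HB Require Import structures.
From mathcomp Require Import all_boot all_order all_fingroup all_algebra.

Set Implicit Arguments.
Unset Strict Implicit.
Unset Printing Implicit Defensive.

Import Order.TTheory GRing.Theory Num.Theory.
Local Open Scope ring_scope.

Section SubgroupLattice.
Variables (gT : finGroupType) (G : {group gT}).

Record subgroup_of := SubgroupOf
  { subgroup_val :> {group gT}; subgroup_of_sub : subgroup_val \subset G }.

HB.instance Definition _ := [isSub of subgroup_of for subgroup_val].
HB.instance Definition _ := [Finite of subgroup_of by <:].

Definition top_subgroup : subgroup_of := SubgroupOf (subxx G).

End SubgroupLattice.

Arguments top_subgroup {gT} G.

Section IncidenceAlgebra.
Variables (gT : finGroupType) (G : {group gT}).
Local Notation L := (subgroup_of G).
Implicit Types H K M : L.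

Definition supported_on_incl (f : {ffun L * L -> int}) : bool :=
  [forall H : L, forall K : L, ~~ (H \subset K) ==> (f (H, K) == 0)].

Record incidence := Incidence
  { incidence_val : {ffun L * L -> int}; _ : supported_on_incl incidence_val }.

HB.instance Definition _ := [isSub for incidence_val].
HB.instance Definition _ := [Choice of incidence by <:].

Definition inc_fun (f : incidence) (H K : L) : int := incidence_val f (H, K).
Local Coercion inc_fun : incidence >-> Funclass.
Implicit Types f g h : incidence.

Lemma supported_on_inclP (f : {ffun L * L -> int}) :
  reflect (forall H K, ~~ (H \subset K) -> f (H, K) = 0) (supported_on_incl f).
Proof.
apply: (iffP forallP) => [sf H K nHK | sf H].
  by apply/eqP; have /forallP/(_ K)/implyP := sf H; apply.
by apply/forallP => K; apply/implyP => /sf/eqP.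
Qed.

Lemma inc_out f H K : ~~ (H \subset K) -> f H K = 0.
Proof. by case: f => f sf; apply/supported_on_inclP. Qed.

Lemma incP f g : (forall H K, H \subset K -> f H K = g H K) -> f = g.
Proof.
move=> eq_fg; apply/val_inj/ffunP => -[H K].
by case: (boolP (H \subset K)) => [/eq_fg|nHK] //; rewrite -!/(inc_fun _ _ _) !inc_out.
Qed.

Fact supported_on_incl_zmod : zmod_closed supported_on_incl.
Proof.
split=> [|f g /supported_on_inclP sf /supported_on_inclP sg].
  by apply/supported_on_inclP => H K _; rewrite ffunE.
by apply/supported_on_inclP => H K nHK; rewrite !ffunE sf ?sg // subr0.
Qed.

HB.instance Definition _ :=
  GRing.SubChoice_isSubZmodule.Build _ _ incidence supported_on_incl_zmod.

Fact inc_of_subproof (E : L -> L -> int) :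
  supported_on_incl [ffun x : L * L => if x.1 \subset x.2 then E x.1 x.2 else 0].
Proof. by apply/supported_on_inclP => H K; rewrite ffunE => /negPf->. Qed.

Definition inc_of (E : L -> L -> int) : incidence :=
  Incidence (inc_of_subproof E).

Lemma inc_ofE E H K : inc_of E H K = if H \subset K then E H K else 0.
Proof. by rewrite /inc_fun ffunE. Qed.

Definition inc_delta : incidence := inc_of (fun H K => (H == K)%:R).

Definition inc_conv f g : incidence :=
  inc_of (fun H K => \sum_(M : L | (H \subset M) && (M \subset K)) f H M * g M K).

Lemma inc_deltaE H K : inc_delta H K = (H == K)%:R.
Proof. by rewrite inc_ofE; case: eqP => [->|]; rewrite ?subxx ?if_same. Qed.

Lemma inc_convE f g H K : inc_conv f g H K = \sum_(M : L) f H M * g M K.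
Proof.
rewrite inc_ofE [RHS](bigID (fun M : L => (H \subset M) && (M \subset K))) /=.
rewrite [X in _ + X]big1 ?addr0 => [|M]; last first.
  by case/nandP => /inc_out-> ; rewrite ?mul0r ?mulr0.
case: ifPn => // nHK; rewrite big_pred0 // => M.
by apply/negP => /andP[sHM /(subset_trans sHM)]; apply/negP.
Qed.

Lemma inc_addE f g H K : (f + g) H K = f H K + g H K.
Proof. by rewrite /inc_fun ffunE. Qed.

Fact inc_convA : associative inc_conv.
Proof.
move=> f g h; apply: incP => H K _; rewrite !inc_convE.
under eq_bigr do rewrite inc_convE mulr_sumr.
rewrite exchange_big; apply: eq_bigr => M _; rewrite inc_convE mulr_suml.
by apply: eq_bigr => N _; rewrite mulrA.
Qed.

Fact inc_conv1l : left_id inc_delta inc_conv.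
Proof.
move=> f; apply: incP => H K _; rewrite inc_convE (bigD1 H) //= big1 => [|M nMH].
  by rewrite inc_deltaE eqxx mul1r addr0.
by rewrite inc_deltaE eq_sym (negPf nMH) mul0r.
Qed.

Fact inc_conv1r : right_id inc_delta inc_conv.
Proof.
move=> f; apply: incP => H K _; rewrite inc_convE (bigD1 K) //= big1 => [|M nMH].
  by rewrite inc_deltaE eqxx mulr1 addr0.
by rewrite inc_deltaE (negPf nMH) mulr0.
Qed.

Fact inc_convDl : left_distributive inc_conv +%R.
Proof.
move=> f g h; apply: incP => H K _; rewrite inc_addE !inc_convE -big_split.
by apply: eq_bigr => M _; rewrite inc_addE mulrDl.
Qed.

Fact inc_convDr : right_distributive inc_conv +%R.
Proof.
move=> f g h; apply: incP => H K _; rewrite inc_addE !inc_convE -big_split.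
by apply: eq_bigr => M _; rewrite inc_addE mulrDr.
Qed.

Fact inc_delta_neq0 : inc_delta != 0.
Proof.
apply/eqP => /(congr1 (fun f : incidence => f (top_subgroup G) (top_subgroup G))).
by rewrite inc_deltaE eqxx /inc_fun ffunE.
Qed.

HB.instance Definition _ := GRing.Zmodule_isNzRing.Build incidence
  inc_convA inc_conv1l inc_conv1r inc_convDl inc_convDr inc_delta_neq0.

Lemma inc_oneE H K : (1 : incidence) H K = (H == K)%:R.
Proof. exact: inc_deltaE. Qed.

Lemma inc_mulE f g H K : (f * g) H K =
  \sum_(M : L | (H \subset M) && (M \subset K)) f H M * g M K.
Proof.
rewrite inc_ofE; case: ifPn => // nHK; rewrite big_pred0 // => M.
by apply/negP => /andP[sHM /(subset_trans sHM)]; apply/negP.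
Qed.

Lemma inc_oppE f H K : (- f) H K = - f H K.
Proof. by rewrite /inc_fun ffunE. Qed.

Lemma inc_mul_diag f g H : (f * g) H H = f H H * g H H.
Proof.
rewrite inc_mulE (big_pred1 H) // => M /=.
by rewrite -eqEsubset eq_sym.
Qed.

(* An element of the incidence algebra is invertible iff its diagonal entries
   are units of int, i.e. 1 or -1; the inverse is then computed by a finite
   geometric series in a nilpotent element.                                 *)
Definition inc_unit : pred incidence :=
  [pred f : incidence | [forall H, f H H \is a GRing.unit]].

Definition inc_diag f : incidence := inc_of (fun H K => f H H *+ (H == K)).

Definition inc_inv f : incidence :=
  if inc_unit f then
    inc_diag f * \sum_(k < #|G|) (1 - f * inc_diag f) ^+ k
  else f.

Lemma inc_diagE f H : inc_diag f H H = f H H.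
Proof. by rewrite inc_ofE subxx eqxx. Qed.

Lemma inc_nilp f : (forall H, f H H = 0) -> f ^+ #|G| = 0.
Proof.
move=> f0; have fk k H K : (#|K| < #|H| + k)%N -> (f ^+ k) H K = 0.
  elim: k H K => [|k IHk] H K.
    rewrite addn0 expr0 inc_oneE => ltKH.
    by case: eqP ltKH => // ->; rewrite ltnn.
  move=> ltK; rewrite exprS inc_mulE big1 // => M /andP[sHM sMK].
  have [<-|neHM] := eqVneq H M; first by rewrite f0 mul0r.
  rewrite IHk ?mulr0 // (leq_trans ltK) // addnS -addSn leq_add2r.
  by rewrite proper_card // properEneq neHM sHM.
apply: incP => H K _; rewrite fk.
  by rewrite /inc_fun ffunE.
rewrite (leq_ltn_trans (subset_leq_card (subgroup_of_sub K))) //.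
by rewrite -[X in (X < _)%N]add0n ltn_add2r cardG_gt0.
Qed.

Lemma inc_mulrV f : inc_unit f -> f * inc_inv f = 1.
Proof.
move=> uf; rewrite /inc_inv uf mulrA.
set n := 1 - _; have -> : f * inc_diag f = 1 - n by rewrite opprB addrC subrK.
have n0 : forall H, n H H = 0.
  move=> H; rewrite inc_addE inc_oppE inc_mul_diag inc_oneE eqxx inc_diagE.
  by have /forallP/(_ H) := uf; rewrite qualifE => /orP[] /eqP ->.
by rewrite -opprB mulNr -subrX1 inc_nilp // sub0r opprK.
Qed.

Lemma inc_unit_mul f g : f * g = 1 -> inc_unit f /\ inc_unit g.
Proof.
move=> fg1; have fgH H : f H H * g H H = 1.
  by rewrite -inc_mul_diag fg1 inc_oneE eqxx.
by split; apply/forallP => H; apply/unitrPr; 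
  [exists (g H H) | exists (f H H); rewrite mulrC].
Qed.

Fact inc_mulVr : {in inc_unit, left_inverse 1 inc_inv *%R}.
Proof.
move=> f uf; have fg1 := inc_mulrV uf.
have /inc_mulrV gh1 := (inc_unit_mul fg1).2.
by rewrite -{2}[f]mulr1 -gh1 (mulrA f) fg1 mul1r gh1.
Qed.

Fact inc_mulrV_in : {in inc_unit, right_inverse 1 inc_inv *%R}.
Proof. by move=> f; apply: inc_mulrV. Qed.

Fact inc_unitP f g : g * f = 1 /\ f * g = 1 -> inc_unit f.
Proof. by case=> _ /inc_unit_mul[]. Qed.

Fact inc_inv_out : {in [predC inc_unit], inc_inv =1 id}.
Proof. by move=> f /negPf nuf; rewrite /inc_inv [inc_unit f]nuf. Qed.

HB.instance Definition _ := GRing.NzRing_hasMulInverse.Build incidence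
  inc_mulVr inc_mulrV_in inc_unitP inc_inv_out.

Definition inc_zeta : incidence := inc_of (fun _ _ => 1).

Definition inc_mu : incidence := inc_zeta^-1.

Definition inc_index : incidence := inc_of (fun H K => #|K : H|%g%:Z).

Definition inc_totient : incidence := inc_index * inc_mu.

Lemma inc_zeta_unit : inc_zeta \is a GRing.unit.
Proof. by apply/forallP => H; rewrite inc_ofE subxx unitr1. Qed.

Lemma inc_index_unit : inc_index \is a GRing.unit.
Proof. by apply/forallP => H; rewrite inc_ofE subxx indexgg. Qed.

Lemma inc_totient_unit : inc_totient \is a GRing.unit.
Proof. by rewrite unitrMl ?unitrV ?inc_zeta_unit ?inc_index_unit. Qed.

End IncidenceAlgebra.

Arguments inc_zeta {gT} G.
Arguments inc_mu {gT} G.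
Arguments inc_index {gT} G.
Arguments inc_totient {gT} G.
Coercion inc_fun : incidence >-> Funclass.

(* Main.v *)
(* For X containing K put
     s(X) = \sum_(F <= H, <H, K> = X) phi^-1(F, H) [X : H].
   A subgroup Y containing K contains H iff it contains <H, K>, so grouping the
   subgroups H <= Y by X = <H, K> and using [X : H] [Y : X] = [Y : H] gives
     \sum_X s(X) i(X, Y) = (phi^-1 * i)(F, Y) = zeta(F, Y) = 1 = zeta(K, Y).
   Convolving with i^-1 on the right yields s = (zeta * i^-1)(K, -) = phi^-1(K, -);
   the theorem is the value of this identity at X = G. *)
Require Import Defs.
From mathcomp Require Import all_boot all_order all_fingroup all_algebra.
Import GRing.Theory.
Local Open Scope ring_scope.

Section Incidence.
Variables (gT : finGroupType) (G : {group gT}).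
Local Notation L := (subgroup_of G).
Implicit Types (H K M X Y : L) (f g : incidence G).

Lemma inc_mul_sumE f g H K : (f * g) H K = \sum_M f H M * g M K.
Proof. exact: inc_convE. Qed.

(** Associativity for a single row vector [u], which need not come from an element of the
    algebra. *)
Lemma inc_row_mulK f (u : L -> int) X : f \is a GRing.unit ->
  \sum_Y (\sum_M u M * f M Y) * f^-1 Y X = u X.
Proof.
move=> uf; under eq_bigr do rewrite mulr_suml.
rewrite exchange_big /=.
have fV M : \sum_Y u M * f M Y * f^-1 Y X = u M * (M == X)%:R.
  under eq_bigr do rewrite -mulrA.
  by rewrite -mulr_sumr -inc_mul_sumE divrr // inc_oneE.
under eq_bigr do rewrite fV.
rewrite (bigD1 X) //= eqxx mulr1 big1 ?addr0 // => M neMX.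
by rewrite (negPf neMX) mulr0.
Qed.

Lemma inc_totientV : (inc_totient G)^-1 = inc_zeta G * (inc_index G)^-1.
Proof.
by rewrite invrM ?unitrV ?inc_zeta_unit ?inc_index_unit // invrK.
Qed.

Lemma inc_totientV_index : (inc_totient G)^-1 * inc_index G = inc_zeta G.
Proof. by rewrite inc_totientV divrK // inc_index_unit. Qed.

Lemma inc_index_mul H X Y : H \subset X -> X \subset Y ->
  inc_index G H X * inc_index G X Y = inc_index G H Y.
Proof.
move=> sHX sXY; rewrite !inc_ofE sHX sXY (subset_trans sHX sXY).
by rewrite -PoszM mulnC Lagrange_index.
Qed.

Definition join_subgroup H K : L :=
  @SubgroupOf gT G (H <*> K)%G
    (introT (joing_subP (A := H) (B := K)) (conj (subgroup_of_sub H) (subgroup_of_sub K))).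

Lemma join_subgroup_eq H K X : ((H <*> K)%g == X) = (X == join_subgroup H K).
Proof.
by rewrite eq_sym; apply/eqP/eqP => [eX | ->] //; do 2!apply: val_inj.
Qed.

Lemma sum_join_index (F K Y : L) (sFK : F \subset K) :
  \sum_(X : L) (\sum_(H : L | (F \subset H) && (H <*> K == X)%g)
            (inc_totient G)^-1 F H * inc_index G H X) * inc_index G X Y
  = inc_zeta G K Y.
Proof.
under eq_bigr do rewrite mulr_suml big_mkcondr /=.
rewrite exchange_big /=.
(* For each [H], only [X = <H, K>] contributes to the inner sum. *)
under eq_bigr => H sFH do
  (under eq_bigr do rewrite join_subgroup_eq; rewrite -big_mkcond big_pred1_eq).
(* If [K] is not inside [Y], no join [H <*> K] is, so every index factor into [Y] vanishes. *)
rewrite [RHS]inc_ofE; case: ifPn => [sKY | nKY]; last first.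
  rewrite big1 // => H _; rewrite [inc_index G _ Y]inc_out ?mulr0 //.
  by apply: contra nKY; apply: subset_trans; apply: joing_subr.
have zFY : inc_zeta G F Y = 1 by rewrite inc_ofE (subset_trans sFK sKY).
rewrite -[RHS]zFY -inc_totientV_index.
rewrite inc_mul_sumE big_mkcond; apply: eq_bigr => H _.
(* The condition [F \subset H] costs nothing: the inverse totient vanishes outside it. *)
case: ifPn => [_ | nFH]; last by rewrite inc_out ?mul0r.
rewrite -mulrA; congr (_ * _); have [sHY | nHY] := boolP (H \subset Y).
  by rewrite inc_index_mul ?joing_subl // join_subG sHY.
rewrite [RHS]inc_out // [inc_index G _ Y]inc_out ?mulr0 //.
by apply: contra nHY; apply: subset_trans; apply: joing_subl.
Qed.

End Incidence.

Theorem proposition6p3 (gT : finGroupType) (G : {group gT})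
    (F K : subgroup_of G) (sFK : F \subset K) :
  ((inc_totient G)^-1 : incidence G) K (top_subgroup G) =
  \sum_(H : subgroup_of G | (F \subset H) && (H <*> K == G)%g)
    ((inc_totient G)^-1 : incidence G) F H * #|G : H|%g%:Z.
Proof.
rewrite {1}inc_totientV inc_mul_sumE.
(* Each [inc_zeta G K Y] becomes a row times the index function, which its inverse then cancels. *)
under eq_bigr => Y _ do rewrite -(sum_join_index _ _ _ _ Y sFK).
rewrite inc_row_mulK ?inc_index_unit //; apply: eq_bigr => H _.
by rewrite inc_ofE subgroup_of_sub.
Qed.
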